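(* Let $\mathcal H$ be a finite-dimensional Hilbert space and let $\mathcal T\subset\mathcal S(\mathcal H)$ be a set of quantum states. Then there exists an entanglement breaking channel $\Lambda:\mathcal L(\mathcal H)\to\mathcal L(\mathcal H)$ such that $\mathcal T\subset\mathrm{Fix}(\Lambda)$ if and only if the triple $(\mathcal T,\mathcal O(\mathcal H),\mathcal O(\mathcal H))$ is broadcastable.
   Context: $\mathcal S(\mathcal H)$ denotes the set of density operators on $\mathcal H$, and $\mathcal O(\mathcal H)$ the set of all observables (POVMs) $\{A_k\}_k$ on $\mathcal H$ (finitely many positive operators with $\sum_k A_k=I$). A channel is a completely positive trace-preserving linear map. An entanglement breaking (measure-and-prepare) channel is one of the form $\Lambda(\rho)=\sum_\lambda \mathrm{tr}[\rho G_\lambda]\sigma_\lambda$ with $\{G_\lambda\}_\lambda$ a POVM and $\sigma_\lambda$ states (finite index set). $\mathrm{Fix}(\Lambda)=\{\rho\in\mathcal S(\mathcal H):\Lambda(\rho)=\rho\}$. For a set of states $\mathcal T$ and sets of observables $\mathcal A,\mathcal B$, the triple $(\mathcal T,\mathcal A,\mathcal B)$ is broadcastable if there is a channel $\Lambda:\mathcal L(\mathcal H)\to\mathcal L(\mathcal H\otimes\mathcal H)$ with $\mathrm{tr}[A_k\,\mathrm{tr}_2\Lambda(\rho)]=\mathrm{tr}[A_k\rho]$ and $\mathrm{tr}[B_k\,\mathrm{tr}_1\Lambda(\rho)]=\mathrm{tr}[B_k\rho]$ for all $\{A_k\}\in\mathcal A$, $\{B_k\}\in\mathcal B$, $\rho\in\mathcal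 T$ and all $k$, where $\mathrm{tr}_i$ is the partial trace over subsystem $i$. *)

(* Defs.v *)
From HB Require Import structures.
From mathcomp Require Import all_boot all_order all_algebra.
From mathcomp Require Import reals.
From mathcomp Require Import complex mxtens.
Set Implicit Arguments. Unset Strict Implicit. Unset Printing Implicit Defensive.
Import Order.TTheory GRing.Theory Num.Theory.
Local Open Scope ring_scope.

Section Quantum.
Variable C : numClosedFieldType.

Definition adjmx (m p : nat) (A : 'M[C]_(m, p)) : 'M[C]_(p, m) :=
  map_mx Num.conj (A^T).

Definition psd (n : nat) (A : 'M[C]_n) : Prop :=
  forall v : 'cV[C]_n, 0 <= (adjmx v *m A *m v) 0 0.

Definition density (n : nat) (rho : 'M[C]_n) : Prop :=
  psd rho /\ \tr rho = 1.

Definition povm (n k : nat) (A : 'I_k -> 'M[C]_n) : Prop :=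
  (forall i, psd (A i)) /\ \sum_(i < k) A i = 1%:M.

Definition obs_set (n : nat) := forall k : nat, ('I_k -> 'M[C]_n) -> Prop.

Definition all_observables (n : nat) : obs_set n := fun k A => povm A.

Definition blockmx (k n : nat) (a b : 'I_k) (X : 'M[C]_(k * n)) : 'M[C]_n :=
  \matrix_(i, j) X (mxtens_index (a, i)) (mxtens_index (b, j)).

(* ampliation id_k (x) L *)
Definition ampl (n m k : nat) (L : 'M[C]_n -> 'M[C]_m) (X : 'M[C]_(k * n))
  : 'M[C]_(k * m) :=
  \matrix_(I, J) L (blockmx (mxtens_unindex I).1 (mxtens_unindex J).1 X)
                    (mxtens_unindex I).2 (mxtens_unindex J).2.

Definition completely_positive (n m : nat) (L : 'M[C]_n -> 'M[C]_m) : Prop :=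
  forall (k : nat) (X : 'M[C]_(k * n)), psd X -> psd (ampl L X).

Definition trace_preserving (n m : nat) (L : 'M[C]_n -> 'M[C]_m) : Prop :=
  forall X, \tr (L X) = \tr X.

Definition channel (n m : nat) (L : 'M[C]_n -> 'M[C]_m) : Prop :=
  linear L /\ completely_positive L /\ trace_preserving L.

Definition mp_map (n k : nat) (G sigma : 'I_k -> 'M[C]_n) (rho : 'M[C]_n)
  : 'M[C]_n := \sum_(l < k) \tr (rho *m G l) *: sigma l.

Definition entanglement_breaking (n : nat) (L : 'M[C]_n -> 'M[C]_n) : Prop :=
  exists (k : nat) (G sigma : 'I_k -> 'M[C]_n),
    povm G /\ (forall l, density (sigma l)) /\ (forall rho, L rho = mp_map G sigma rho).

Definition ptr1 (n : nat) (Y : 'M[C]_(n * n)) : 'M[C]_n :=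
  \matrix_(i, j) \sum_(a < n) Y (mxtens_index (a, i)) (mxtens_index (a, j)).
Definition ptr2 (n : nat) (Y : 'M[C]_(n * n)) : 'M[C]_n :=
  \matrix_(i, j) \sum_(b < n) Y (mxtens_index (i, b)) (mxtens_index (j, b)).

Definition broadcastable (n : nat) (T : 'M[C]_n -> Prop) (OA OB : obs_set n)
  : Prop :=
  exists L : 'M[C]_n -> 'M[C]_(n * n), channel L /\
    (forall k (A : 'I_k -> 'M[C]_n), OA k A -> forall rho, T rho ->
       forall i, \tr (A i *m ptr2 (L rho)) = \tr (A i *m rho)) /\
    (forall k (B : 'I_k -> 'M[C]_n), OB k B -> forall rho, T rho ->
       forall i, \tr (B i *m ptr1 (L rho)) = \tr (B i *m rho)).

End Quantum.
Arguments all_observables {C} n _ _.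

(* Main.v *)
Require Import Defs.
From HB Require Import structures.
From mathcomp Require Import all_boot all_order all_algebra.
From mathcomp Require Import boolp reals.
From mathcomp Require Import complex mxtens ring.
Import Order.TTheory GRing.Theory Num.Theory.
Local Open Scope ring_scope.

Set Implicit Arguments.
Unset Strict Implicit.
Unset Printing Implicit Defensive.

(* A measure-and-prepare channel can prepare two copies of its output, which
   broadcasts its fixed states.  Conversely, since observables separate states,
   both marginals of a broadcasting channel L fix T.  Cut L down to the support
   Q of a psd matrix rho of maximal rank fixed by both marginals, and let F, G
   be the Heisenberg duals of the two marginals so obtained.  If F A = A, then
   invariance of the faithful rho forces equality in the Kadison-Schwarz
   inequality, so A commutes with the Kraus operators of the first marginal;
   hence A commutes with the whole range of G, and F is Fix(F)-bimodular.  Let P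
   be the ergodic projection onto Fix(F).  Then P o G is positive, satisfies
   tr (s (P o G) X) = tr (s X) for s in T, and its range is commutative: it lies
   in the centre of Fix(F).  Diagonalising this range in a common orthonormal
   basis exhibits the predual of P o G as a measure-and-prepare map. *)

(** * Adjoints and positive semidefinite matrices *)

Section Adjoint.
Variable C : numClosedFieldType.

Lemma adjmxE m n (A : 'M[C]_(m, n)) i j : adjmx A i j = (A j i)^*.
Proof. by rewrite !mxE. Qed.

Lemma adjmxK m n (A : 'M[C]_(m, n)) : adjmx (adjmx A) = A.
Proof. by apply/matrixP=> i j; rewrite !adjmxE conjCK. Qed.

Lemma adjmxM m n p (A : 'M[C]_(m, n)) (B : 'M[C]_(n, p)) :
  adjmx (A *m B) = adjmx B *m adjmx A.
Proof. by rewrite /adjmx trmx_mul map_mxM. Qed.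

Lemma adjmxD m n (A B : 'M[C]_(m, n)) : adjmx (A + B) = adjmx A + adjmx B.
Proof. by rewrite /adjmx linearD /= map_mxD. Qed.

Lemma adjmxB m n (A B : 'M[C]_(m, n)) : adjmx (A - B) = adjmx A - adjmx B.
Proof. by rewrite /adjmx linearB /= map_mxB. Qed.

Lemma adjmxZ m n a (A : 'M[C]_(m, n)) : adjmx (a *: A) = a^* *: adjmx A.
Proof. by rewrite /adjmx linearZ /= map_mxZ. Qed.

Lemma adjmx1 n : adjmx (1%:M : 'M[C]_n) = 1%:M.
Proof. by rewrite /adjmx trmx1 map_mx1. Qed.

Lemma adjmx_sum m n (I : finType) (F : I -> 'M[C]_(m, n)) :
  adjmx (\sum_i F i) = \sum_i adjmx (F i).
Proof. by rewrite /adjmx linear_sum /= map_mx_sum. Qed.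

Lemma adjmx_delta m n i j : adjmx (delta_mx i j : 'M[C]_(m, n)) = delta_mx j i.
Proof. by rewrite /adjmx trmx_delta map_delta_mx. Qed.

(** Polarisation: the vectors [e i + t *: e j] with [t = 'i] and [t = 1] give two independent
    relations between the values of [f] at [delta_mx i j] and [delta_mx j i]. *)
Lemma linear_rank1_eq0 n (V : lmodType C) (f : {linear 'M[C]_n -> V}) :
  (forall v : 'cV_n, f (v *m adjmx v) = 0) -> forall X, f X = 0.
Proof.
move=> f0 X; rewrite [X]matrix_sum_delta linear_sum big1 // => i _.
rewrite linear_sum big1 // => j _; rewrite linearZ /=.
pose e k : 'cV[C]_n := delta_mx k 0.
have eE k l : e k *m adjmx (e l) = delta_mx k l.
  by rewrite adjmx_delta mul_delta_mx.
have fd k : f (delta_mx k k) = 0 by rewrite -eE f0.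
have ft t : t^* *: f (delta_mx i j) + t *: f (delta_mx j i) = 0.
  have := f0 (e i + t *: e j).
  rewrite adjmxD adjmxZ mulmxDl !mulmxDr -!scalemxAl -!scalemxAr !eE.
  by rewrite !linearD !linearZ /= !fd !scaler0 addr0 add0r.
have /(congr1 ( *:%R 'i)) := ft 'i.
rewrite conjCi scalerDr !scalerA scaler0 mulrN -expr2 sqrCi opprK scaleN1r scale1r.
move/eqP; rewrite subr_eq0 => /eqP eqf.
have := ft 1; rewrite conjC1 !scale1r -eqf -mulr2n -scaler_nat => /eqP.
by rewrite scaler_eq0 pnatr_eq0 /= => /eqP->; rewrite scaler0.
Qed.

Lemma mxtrace_form_inj n (A B : 'M[C]_n) :
  (forall X, \tr (A *m X) = \tr (B *m X)) -> A = B.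
Proof.
move=> eqAB; apply/matrixP=> i j.
have tr_delta (D : 'M[C]_n) : \tr (D *m delta_mx j i) = D i j.
  rewrite /mxtrace (bigD1 i) //= big1 ?addr0.
    rewrite mxE (bigD1 j) //= big1 ?addr0 ?mxE ?eqxx ?mulr1 //.
    by move=> k /negPf kj; rewrite mxE kj mulr0.
  move=> k /negPf ki; rewrite mxE big1 // => l _.
  by rewrite mxE ki andbF mulr0.
by rewrite -!tr_delta eqAB.
Qed.

Lemma mxtrace_rank1 n (A : 'M[C]_n) (v : 'cV_n) :
  \tr (A *m (v *m adjmx v)) = (adjmx v *m A *m v) 0 0.
Proof. by rewrite mulmxA mxtrace_mulC mulmxA /mxtrace big_ord1. Qed.

Lemma form_inj n (A B : 'M[C]_n) :
  (forall v : 'cV_n, (adjmx v *m A *m v) 0 0 = (adjmx v *m B *m v) 0 0) -> A = B.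
Proof.
move=> eqAB; apply: mxtrace_form_inj => X; apply/eqP; rewrite -subr_eq0.
rewrite -raddfB /= -mulmxBl; apply/eqP.
have lin : scalar (fun X => \tr ((A - B) *m X)).
  by move=> a Y Z; rewrite mulmxDr -scalemxAr mxtraceD mxtraceZ.
pose f : {linear 'M[C]_n -> C^o} := HB.pack (fun X => \tr ((A - B) *m X))
  (GRing.isLinear.Build _ _ _ _ _ lin).
apply: (linear_rank1_eq0 (f := f)) => v /=.
by rewrite mxtrace_rank1 mulmxBr mulmxBl mxE [in X in _ + X]mxE eqAB subrr.
Qed.

Lemma sqnormE n (v : 'cV[C]_n) : (adjmx v *m v) 0 0 = \sum_i `|v i 0| ^+ 2.
Proof. by rewrite mxE; apply: eq_bigr => i _; rewrite adjmxE normCKC. Qed.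

Lemma sqnorm_ge0 n (v : 'cV[C]_n) : 0 <= (adjmx v *m v) 0 0.
Proof. by rewrite sqnormE sumr_ge0 // => i _; rewrite exprn_ge0. Qed.

Lemma form_bound n (A : 'M[C]_n) : exists2 c, 0 <= c &
  forall v : 'cV_n, `|(adjmx v *m A *m v) 0 0| <= c * (adjmx v *m v) 0 0.
Proof.
(* This constant works because a product of two coordinate moduli is at most the square of the
   larger one, hence at most the squared norm of [v]. *)
exists (\sum_i \sum_j `|A i j|).
  by apply: sumr_ge0 => i _; apply: sumr_ge0 => j _.
move=> v; have vle i : `|v i 0| ^+ 2 <= (adjmx v *m v) 0 0.
  by rewrite sqnormE (bigD1 i) //= lerDl sumr_ge0 // => j _; rewrite exprn_ge0.
have vle2 i j : `|v i 0| * `|v j 0| <= (adjmx v *m v) 0 0.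
  have [le|/ltW le] := real_leP (normr_real (v i 0)) (normr_real (v j 0)).
    by apply: le_trans (vle j); rewrite expr2 ler_wpM2r.
  by apply: le_trans (vle i); rewrite expr2 ler_wpM2l.
rewrite -mulmxA mxE mulr_suml; apply: le_trans (ler_norm_sum _ _ _) _.
apply: ler_sum => i _; rewrite [X in _ * X]mxE mulr_sumr mulr_suml.
apply: le_trans (ler_norm_sum _ _ _) _; apply: ler_sum => j _.
by rewrite !normrM adjmxE norm_conjC mulrCA ler_wpM2l.
Qed.

End Adjoint.

Section Psd.
Variable C : numClosedFieldType.

Lemma psd_adjmx n (A : 'M[C]_n) : psd A -> adjmx A = A.
Proof.
move=> psdA; apply: form_inj => v.
have -> : (adjmx v *m adjmx A *m v) = adjmx (adjmx v *m A *m v).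
  by rewrite !adjmxM adjmxK mulmxA.
by rewrite adjmxE; apply/CrealP/ger0_real/psdA.
Qed.

Lemma psdD n (A B : 'M[C]_n) : psd A -> psd B -> psd (A + B).
Proof. by move=> pA pB v; rewrite mulmxDr mulmxDl mxE addr_ge0. Qed.

Lemma psdZ n a (A : 'M[C]_n) : 0 <= a -> psd A -> psd (a *: A).
Proof. by move=> a0 pA v; rewrite -scalemxAr -scalemxAl mxE mulr_ge0. Qed.

Lemma psd0 n : psd (0 : 'M[C]_n).
Proof. by move=> v; rewrite mulmx0 mul0mx mxE. Qed.

Lemma psd_sum n (I : finType) (F : I -> 'M[C]_n) :
  (forall i, psd (F i)) -> psd (\sum_i F i).
Proof. by move=> pF; elim/big_rec: _ => [|i A _]; [exact: psd0 | apply: psdD]. Qed.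

Lemma psd_conjmx m n (B : 'M[C]_(m, n)) A : psd A -> psd (B *m A *m adjmx B).
Proof.
move=> pA v; have := pA (adjmx B *m v).
by rewrite adjmxM adjmxK !mulmxA.
Qed.

Lemma psd1 n : psd (1%:M : 'M[C]_n).
Proof. by move=> v; rewrite mulmx1 sqnorm_ge0. Qed.

Lemma psd_gram m n (B : 'M[C]_(m, n)) : psd (B *m adjmx B).
Proof. by rewrite -[B in psd (B *m _)]mulmx1; apply/psd_conjmx/psd1. Qed.

Lemma psd_diag n (A : 'M[C]_n) i : psd A -> 0 <= A i i.
Proof.
move=> /(_ (delta_mx i 0)); rewrite adjmx_delta -mulmxA -colE.
by rewrite -rowE mxE mxE.
Qed.

Lemma psd_mxtrace n (A : 'M[C]_n) : psd A -> 0 <= \tr A.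
Proof. by move=> pA; apply: sumr_ge0 => i _; apply: psd_diag. Qed.

Lemma psd_spectral n (A : 'M[C]_n) : psd A ->
  exists (U : 'M[C]_n) (d : 'rV[C]_n), [/\ U *m adjmx U = 1%:M,
    adjmx U *m U = 1%:M, forall i, 0 <= d 0 i & A = adjmx U *m diag_mx d *m U].
Proof.
move=> pA; have nA : A \is normalmx.
  by apply/normalmxP; rewrite -/(adjmx A) psd_adjmx.
have /orthomx_spectralP := nA.
set U := spectralmx A; set d := spectral_diag A => AE.
have /unitarymxP UU : U \is unitarymx by exact: spectral_unitarymx.
have UU' : adjmx U *m U = 1%:M by exact: mulmx1C UU.
have AE' : A = adjmx U *m diag_mx d *m U.
  by rewrite AE invmx_unitary // spectral_unitarymx.
exists U, d; split=> // i.
have -> : d 0 i = (U *m A *m adjmx U) i i.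
  rewrite AE' !mulmxA UU mul1mx -mulmxA UU mulmx1.
  by rewrite mxE eqxx mulr1n.
exact/psd_diag/psd_conjmx.
Qed.

Lemma psd_factor n (A : 'M[C]_n) : psd A -> exists B : 'M[C]_n, A = B *m adjmx B.
Proof.
case/psd_spectral => U [d [_ _ d0 ->]].
exists (adjmx U *m diag_mx (\row_i sqrtC (d 0 i))).
rewrite adjmxM adjmxK mulmxA; congr (_ *m U); rewrite -mulmxA; congr (_ *m _).
apply/matrixP=> i j; rewrite mul_diag_mx !mxE.
case: eqVneq => [->|ne]; last by rewrite conjC0 mulr0.
rewrite !mulr1n; have /CrealP -> : sqrtC (d 0 j) \is Num.real.
  by apply: ger0_real; rewrite sqrtC_ge0.
by rewrite -expr2 sqrtCK.
Qed.

Lemma mxtrace_gram_ge0 m n (Z : 'M[C]_(m, n)) : 0 <= \tr (Z *m adjmx Z).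
Proof. exact/psd_mxtrace/psd_gram. Qed.

Lemma mxtrace_gram_eq0 m n (Z : 'M[C]_(m, n)) : \tr (Z *m adjmx Z) = 0 -> Z = 0.
Proof.
have E i : (Z *m adjmx Z) i i = \sum_j `|Z i j| ^+ 2.
  by rewrite mxE; apply: eq_bigr => j _; rewrite adjmxE normCK.
rewrite /mxtrace (eq_bigr _ (fun i _ => E i)) => /psumr_eq0P z0.
apply/matrixP=> i j; rewrite mxE.
have /psumr_eq0P zi0 := z0 (fun i _ => sumr_ge0 _ (fun j _ => exprn_ge0 2 (normr_ge0 (Z i j)))) i isT.
have /eqP := zi0 (fun j _ => exprn_ge0 2 (normr_ge0 (Z i j))) j isT.
by rewrite expf_eq0 /= normr_eq0 => /eqP.
Qed.

(** Writing [rho] as [B *m adjmx B] turns each summand into the squared Hilbert-Schmidt norm of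
    [Z i *m B]. *)
Lemma faithful_sum n (I : finType) (rho : 'M[C]_n) (Z : I -> 'M[C]_n) :
  psd rho -> \sum_i \tr (rho *m (adjmx (Z i) *m Z i)) = 0 ->
  forall i, Z i *m rho = 0.
Proof.
case/psd_factor => B ->.
have E i : \tr (B *m adjmx B *m (adjmx (Z i) *m Z i)) =
           \tr (Z i *m B *m adjmx (Z i *m B)).
  by rewrite adjmxM mulmxA mxtrace_mulC !mulmxA.
rewrite (eq_bigr _ (fun i _ => E i)) => /psumr_eq0P z0 i.
by rewrite mulmxA (mxtrace_gram_eq0 (z0 _ i isT)) ?mul0mx // => j _; apply: mxtrace_gram_ge0.
Qed.

End Psd.

(** * Kraus operators and partial traces *)

Section Kraus.
Variable C : numClosedFieldType.

Lemma big_mxtens (V : nmodType) m n (F : 'I_(m * n) -> V) :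
  \sum_i F i = \sum_a \sum_b F (mxtens_index (a, b)).
Proof.
rewrite pair_bigA (reindex (@mxtens_index m n)) /=.
  by apply: eq_bigr => -[].
by exists (@mxtens_unindex m n) => i _; rewrite (mxtens_indexK, mxtens_unindexK).
Qed.

Definition kraus_map (I : finType) m n (K : I -> 'M[C]_(m, n)) (X : 'M[C]_n) :=
  \sum_i K i *m X *m adjmx (K i).

Lemma kraus_map_linear (I : finType) m n (K : I -> 'M[C]_(m, n)) :
  linear (kraus_map K).
Proof.
move=> a X Y; rewrite scaler_sumr -big_split; apply: eq_bigr => i _.
by rewrite mulmxDr mulmxDl -scalemxAr -scalemxAl.
Qed.

Lemma blockmx_ampl k m n (L : 'M[C]_n -> 'M[C]_m) a b (X : 'M_(k * n)) :
  blockmx a b (ampl L X) = L (blockmx a b X).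
Proof. by apply/matrixP=> i j; rewrite !mxE !mxtens_indexK. Qed.

Lemma blockmx_inj k n (X Y : 'M[C]_(k * n)) :
  (forall a b, blockmx a b X = blockmx a b Y) -> X = Y.
Proof.
move=> eqXY; apply/matrixP=> i j.
case: (mxtens_indexP i) => a i'; case: (mxtens_indexP j) => b j'.
by have /matrixP/(_ i' j') := eqXY a b; rewrite !mxE.
Qed.

Lemma blockmx_sum k n (I : finType) (F : I -> 'M[C]_(k * n)) a b :
  blockmx a b (\sum_i F i) = \sum_i blockmx a b (F i).
Proof.
by apply/matrixP=> i j; rewrite mxE !summxE; apply: eq_bigr => l _; rewrite mxE.
Qed.

Lemma tens1mxE k m n (B : 'M[C]_(m, n)) (a b : 'I_k) i j :
  tensmx 1%:M B (mxtens_index (a, i)) (mxtens_index (b, j)) = (a == b)%:R * B i j.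
Proof. by rewrite mxE !mxtens_indexK mxE. Qed.

Lemma blockmx_conj_tens1 k m n (B : 'M[C]_(m, n)) (X : 'M_(k * n)) a b :
  blockmx a b (tensmx 1%:M B *m X *m adjmx (tensmx 1%:M B))
    = B *m blockmx a b X *m adjmx B.
Proof.
apply/matrixP=> i j; rewrite mxE mxE big_mxtens (bigD1 b) //= [X in _ + X]big1.
  rewrite addr0 [RHS]mxE; apply: eq_bigr => j' _.
  rewrite !adjmxE tens1mxE eqxx mul1r; congr (_ * _).
  rewrite mxE big_mxtens (bigD1 a) //= [X in _ + X]big1.
    rewrite addr0 [RHS]mxE; apply: eq_bigr => i' _.
    by rewrite tens1mxE eqxx mul1r mxE.
  move=> a' /negPf ne; rewrite big1 // => i' _.
  by rewrite tens1mxE eq_sym ne !mul0r.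
move=> b' /negPf ne; rewrite big1 // => j' _.
by rewrite adjmxE tens1mxE eq_sym ne mul0r conjC0 mulr0.
Qed.

Lemma kraus_map_cp (I : finType) m n (K : I -> 'M[C]_(m, n)) :
  completely_positive (kraus_map K).
Proof.
move=> k X pX.
have -> : ampl (kraus_map K) X =
    \sum_i tensmx 1%:M (K i) *m X *m adjmx (tensmx 1%:M (K i)).
  apply: blockmx_inj => a b; rewrite blockmx_ampl blockmx_sum.
  by apply: eq_bigr => i _; rewrite blockmx_conj_tens1.
by apply: psd_sum => i; apply: psd_conjmx.
Qed.

(* Choi: the ampliation of [L] applied to the unnormalised maximally entangled
   projector is psd, and the columns of a square root of it are the vectorised
   Kraus operators. *)
Lemma cp_kraus m n (L : 'M[C]_n -> 'M[C]_m) :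
  linear L -> completely_positive L ->
  exists K : 'I_(n * m) -> 'M[C]_(m, n), forall X, L X = kraus_map K X.
Proof.
move=> linL cpL.
pose w : 'cV[C]_(n * n) :=
  \col_i ((mxtens_unindex i).1 == (mxtens_unindex i).2)%:R.
have /psd_factor [B BE] := cpL n _ (psd_gram w).
have wE a b : blockmx a b (w *m adjmx w) = delta_mx a b.
  apply/matrixP=> i j; rewrite mxE mxE big_ord1 adjmxE !mxE !mxtens_indexK /=.
  by rewrite conjC_nat -natrM mulnb (eq_sym a) (eq_sym b).
pose K (l : 'I_(n * m)) := \matrix_(i, a) B (mxtens_index (a, i)) l : 'M[C]_(m, n).
exists K => X.
pose f : {linear 'M[C]_n -> 'M[C]_m} := HB.pack L
  (GRing.isLinear.Build _ _ _ _ _ linL).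
pose g : {linear 'M[C]_n -> 'M[C]_m} := HB.pack (kraus_map K)
  (GRing.isLinear.Build _ _ _ _ _ (kraus_map_linear K)).
have fgE a b : f (delta_mx a b) = g (delta_mx a b).
  rewrite /= -wE -blockmx_ampl BE wE; apply/matrixP=> i j.
  rewrite mxE mxE summxE; apply: eq_bigr => l _.
  rewrite -[delta_mx a b](mul_delta_mx (0 : 'I_1)) mulmxA -mulmxA -rowE -colE.
  by rewrite [RHS]mxE big_ord1 !mxE.
rewrite -[L X]/(f X) -[RHS]/(g X) [X]matrix_sum_delta !linear_sum.
apply: eq_bigr => i _; rewrite !linear_sum; apply: eq_bigr => j _.
by rewrite !linearZ fgE.
Qed.

(** The matrix units are Kraus operators of the map sending [Y] to its trace times the identity;
    this is how a trace enters a Kraus form below. *)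
Lemma sum_delta_conj n (Y : 'M[C]_n) m :
  \sum_(i < m) \sum_j (delta_mx i j : 'M[C]_(m, n)) *m Y *m delta_mx j i = (\tr Y)%:M.
Proof.
rewrite exchange_big /= /mxtrace raddf_sum; apply: eq_bigr => j _.
have E i : (delta_mx i j : 'M[C]_(m, n)) *m Y *m delta_mx j i =
    Y j j *: delta_mx i i.
  apply/matrixP=> k l.
  rewrite -(mul_delta_mx (0 : 'I_1)) -[delta_mx j i](mul_delta_mx (0 : 'I_1)).
  rewrite -!mulmxA (mulmxA _ _ (delta_mx 0 i)) (mulmxA (delta_mx 0 j)).
  rewrite -rowE -colE mulmxA mxE big_ord1 [X in _ * X]mxE [X in X * _]mxE big_ord1.
  by rewrite !mxE !eqxx !andbT /= mulrAC mulrC -natrM mulnb.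
rewrite (eq_bigr _ (fun i _ => E i)) -scaler_sumr -mx1_sum_delta.
by rewrite scalemx1.
Qed.

(** Factoring [G l] through [B l] and [tau l] through [D l], each term becomes a scalar matrix
    conjugated by [D l], which [sum_delta_conj] expands. *)
Lemma measure_prepare_kraus (I : finType) m n
    (G : I -> 'M[C]_n) (tau : I -> 'M[C]_m) :
  (forall l, psd (G l)) -> (forall l, psd (tau l)) ->
  exists (J : finType) (K : J -> 'M[C]_(m, n)), forall X,
    \sum_l \tr (X *m G l) *: tau l = kraus_map K X.
Proof.
move=> pG pt.
have [B BE] := fin_all_exists (fun l => psd_factor (pG l)).
have [D DE] := fin_all_exists (fun l => psd_factor (pt l)).
pose K (x : I * ('I_m * 'I_n)) :=
  D x.1 *m delta_mx x.2.1 x.2.2 *m adjmx (B x.1).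
exists (I * ('I_m * 'I_n))%type, K => X; rewrite /kraus_map.
transitivity (\sum_i \sum_p K (i, p) *m X *m adjmx (K (i, p))); last first.
  by rewrite pair_bigA; apply: eq_bigr => -[].
apply: eq_bigr => l _.
have -> : \tr (X *m G l) = \tr (adjmx (B l) *m X *m B l).
  by rewrite BE mulmxA mxtrace_mulC mulmxA.
set Y := adjmx _ *m X *m _.
rewrite -mul_scalar_mx [tau l]DE mulmxA -scalar_mxC -sum_delta_conj.
rewrite pair_bigA mulmx_sumr mulmx_suml; apply: eq_bigr => -[i j] _.
by rewrite /K /= !adjmxM adjmxK adjmx_delta /Y !mulmxA.
Qed.

End Kraus.

Section PartialTrace.
Variables (C : numClosedFieldType) (n : nat).

Lemma mxtrace_ptr2 (Y : 'M[C]_(n * n)) : \tr (ptr2 Y) = \tr Y.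
Proof.
by rewrite /mxtrace big_mxtens; apply: eq_bigr => i _; rewrite mxE.
Qed.

Lemma mxtrace_ptr1 (Y : 'M[C]_(n * n)) : \tr (ptr1 Y) = \tr Y.
Proof.
rewrite /mxtrace big_mxtens exchange_big.
by apply: eq_bigr => i _; rewrite mxE.
Qed.

Lemma ptr2_sum (I : finType) (F : I -> 'M[C]_(n * n)) :
  ptr2 (\sum_i F i) = \sum_i ptr2 (F i).
Proof.
apply/matrixP=> i j; rewrite mxE summxE.
transitivity (\sum_b \sum_l F l (mxtens_index (i, b)) (mxtens_index (j, b))).
  by apply: eq_bigr => b _; rewrite summxE.
by rewrite exchange_big; apply: eq_bigr => l _; rewrite mxE.
Qed.

Lemma ptr1_sum (I : finType) (F : I -> 'M[C]_(n * n)) :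
  ptr1 (\sum_i F i) = \sum_i ptr1 (F i).
Proof.
apply/matrixP=> i j; rewrite mxE summxE.
transitivity (\sum_b \sum_l F l (mxtens_index (b, i)) (mxtens_index (b, j))).
  by apply: eq_bigr => b _; rewrite summxE.
by rewrite exchange_big; apply: eq_bigr => l _; rewrite mxE.
Qed.

Lemma ptr2Z a (Y : 'M[C]_(n * n)) : ptr2 (a *: Y) = a *: ptr2 Y.
Proof.
by apply/matrixP=> i j; rewrite !mxE mulr_sumr; apply: eq_bigr => b _; rewrite mxE.
Qed.

Lemma ptr1Z a (Y : 'M[C]_(n * n)) : ptr1 (a *: Y) = a *: ptr1 Y.
Proof.
by apply/matrixP=> i j; rewrite !mxE mulr_sumr; apply: eq_bigr => b _; rewrite mxE.
Qed.

Lemma ptr2_tens (A B : 'M[C]_n) : ptr2 (tensmx A B) = \tr B *: A.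
Proof.
apply/matrixP=> i j; rewrite !mxE mulrC mulr_sumr; apply: eq_bigr => b _.
by rewrite mxE !mxtens_indexK.
Qed.

Lemma ptr1_tens (A B : 'M[C]_n) : ptr1 (tensmx A B) = \tr A *: B.
Proof.
apply/matrixP=> i j; rewrite !mxE mulr_suml; apply: eq_bigr => b _.
by rewrite mxE !mxtens_indexK.
Qed.

Lemma psd_tens (A B : 'M[C]_n) : psd A -> psd B -> psd (tensmx A B).
Proof.
move=> /psd_factor [D ->] /psd_factor [E ->]; rewrite -tensmx_mul.
have <- : adjmx (tensmx D E) = tensmx (adjmx D) (adjmx E).
  apply/matrixP=> i j.
  by rewrite adjmxE [in LHS]mxE [RHS]mxE !adjmxE rmorphM.
exact: psd_gram.
Qed.

(* [slice2 K b] is (id (x) <b|) K and [slice1 K a] is (<a| (x) id) K: over all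
   [b] (resp. [a]) these are Kraus operators of the marginals of K . K^*. *)
Definition slice2 (K : 'M[C]_(n * n, n)) (b : 'I_n) : 'M[C]_n :=
  \matrix_(a, j) K (mxtens_index (a, b)) j.
Definition slice1 (K : 'M[C]_(n * n, n)) (a : 'I_n) : 'M[C]_n :=
  \matrix_(b, j) K (mxtens_index (a, b)) j.

Lemma ptr2_conj (K : 'M[C]_(n * n, n)) X :
  ptr2 (K *m X *m adjmx K) = \sum_b slice2 K b *m X *m adjmx (slice2 K b).
Proof.
apply/matrixP=> i j; rewrite mxE summxE; apply: eq_bigr => b _.
rewrite !mxE; apply: eq_bigr => k _; rewrite !adjmxE !mxE; congr (_ * _).
by apply: eq_bigr => l _; rewrite !mxE.
Qed.

Lemma ptr1_conj (K : 'M[C]_(n * n, n)) X :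
  ptr1 (K *m X *m adjmx K) = \sum_b slice1 K b *m X *m adjmx (slice1 K b).
Proof.
apply/matrixP=> i j; rewrite mxE summxE; apply: eq_bigr => b _.
rewrite !mxE; apply: eq_bigr => k _; rewrite !adjmxE !mxE; congr (_ * _).
by apply: eq_bigr => l _; rewrite !mxE.
Qed.

End PartialTrace.

(** * From measure-and-prepare channels to broadcasting *)

Section Forward.
Variables (C : numClosedFieldType) (n : nat).

Lemma mxtrace_tens (A B : 'M[C]_n) : \tr (tensmx A B) = \tr A * \tr B.
Proof. by rewrite -mxtrace_ptr2 ptr2_tens mxtraceZ mulrC. Qed.

Lemma entanglement_breaking_broadcast (T : 'M[C]_n -> Prop) L :
  entanglement_breaking L -> (forall rho, T rho -> L rho = rho) ->
  broadcastable T (all_observables n) (all_observables n).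
Proof.
move=> [k [G [sigma [[pG sumG] [dsigma LE]]]]] fixL.
(* Two copies are prepared; as [sigma l] has trace 1, both marginals of [L'] equal [L]. *)
pose tau l := tensmx (sigma l) (sigma l).
have ptau l : psd (tau l) by apply: psd_tens; case: (dsigma l).
pose L' X := \sum_l \tr (X *m G l) *: tau l.
have [J [K KE]] := measure_prepare_kraus pG ptau.
have p2 X : ptr2 (L' X) = L X.
  rewrite LE ptr2_sum; apply: eq_bigr => l _.
  by rewrite ptr2Z ptr2_tens; case: (dsigma l) => _ ->; rewrite scale1r.
have p1 X : ptr1 (L' X) = L X.
  rewrite LE ptr1_sum; apply: eq_bigr => l _.
  by rewrite ptr1Z ptr1_tens; case: (dsigma l) => _ ->; rewrite scale1r.
exists L'; split; [split; [|split] | split].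
- move=> a X Y; rewrite /L' !KE; exact: kraus_map_linear.
- move=> m X pX.
  have -> : ampl L' X = ampl (kraus_map K) X.
    by apply: blockmx_inj => a b; rewrite !blockmx_ampl -KE.
  exact: kraus_map_cp.
- move=> X; rewrite raddf_sum /= -[in RHS](mulmx1 X) -sumG mulmx_sumr raddf_sum.
  apply: eq_bigr => l _; rewrite /= mxtraceZ mxtrace_tens.
  by case: (dsigma l) => _ ->; rewrite !mulr1.
- by move=> m A _ rho Trho i; rewrite p2 fixL.
- by move=> m A _ rho Trho i; rewrite p1 fixL.
Qed.

End Forward.

(** * The ergodic projection of a subunital completely positive map *)

Section HeisenbergMap.
Variable C : numClosedFieldType.

(** Heisenberg picture: the adjoint of [kraus_map K] for the trace pairing. *)
Definition dual_map (I : finType) m n (K : I -> 'M[C]_(m, n)) (X : 'M[C]_m) :=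
  \sum_i adjmx (K i) *m X *m K i.

Lemma dual_map_linear (I : finType) m n (K : I -> 'M[C]_(m, n)) :
  linear (dual_map K).
Proof.
move=> a X Y; rewrite scaler_sumr -big_split; apply: eq_bigr => i _.
by rewrite mulmxDr mulmxDl -scalemxAr -scalemxAl.
Qed.

HB.instance Definition _ (I : finType) m n (K : I -> 'M[C]_(m, n)) :=
  GRing.isLinear.Build C 'M[C]_m 'M[C]_n _ (dual_map K) (dual_map_linear K).

Lemma dual_map_form (I : finType) m n (K : I -> 'M[C]_(m, n)) X (v : 'cV_n) :
  (adjmx v *m dual_map K X *m v) 0 0 =
  \sum_i (adjmx (K i *m v) *m X *m (K i *m v)) 0 0.
Proof.
rewrite mulmx_sumr mulmx_suml summxE; apply: eq_bigr => i _.
by rewrite adjmxM !mulmxA.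
Qed.

Lemma dual_map_psd (I : finType) m n (K : I -> 'M[C]_(m, n)) X :
  psd X -> psd (dual_map K X).
Proof. by move=> pX v; rewrite dual_map_form sumr_ge0. Qed.

Lemma adjmx_dual_map (I : finType) m n (K : I -> 'M[C]_(m, n)) X :
  adjmx (dual_map K X) = dual_map K (adjmx X).
Proof.
by rewrite adjmx_sum; apply: eq_bigr => i _; rewrite !adjmxM adjmxK mulmxA.
Qed.

Lemma mxtrace_dual_map (I : finType) m n (K : I -> 'M[C]_(m, n)) rho X :
  \tr (rho *m dual_map K X) = \tr (kraus_map K rho *m X).
Proof.
rewrite mulmx_sumr mulmx_suml !raddf_sum; apply: eq_bigr => i _ /=.
by rewrite !mulmxA mxtrace_mulC !mulmxA.
Qed.

(** The bound is applied to each [K i *m v]; the squared norms of these vectors add up to the form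
    of [dual_map K 1%:M] at [v], which is at most that of the identity. *)
Lemma dual_map_bound (I : finType) n (K : I -> 'M[C]_n) c X :
  psd (1%:M - dual_map K 1%:M) -> 0 <= c ->
  (forall v : 'cV_n, `|(adjmx v *m X *m v) 0 0| <= c * (adjmx v *m v) 0 0) ->
  forall v : 'cV_n,
    `|(adjmx v *m dual_map K X *m v) 0 0| <= c * (adjmx v *m v) 0 0.
Proof.
move=> sub1 c0 bX v; rewrite dual_map_form.
apply: le_trans (ler_norm_sum _ _ _) _.
apply: le_trans (ler_sum _ (fun i _ => bX (K i *m v))) _.
rewrite -mulr_sumr ler_wpM2l // -subr_ge0.
have := sub1 v; rewrite mulmxBr mulmxBl mulmx1 mxE [X in _ + X]mxE dual_map_form.
by under eq_bigr => i _ do rewrite mulmx1.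
Qed.

End HeisenbergMap.

(** * Archimedean bounds for the order on complex numbers *)

Section Archimedes.
Variable R : realType.

Lemma archimedean_le0 (x y : R) : (forall N, x *+ N <= y) -> x <= 0.
Proof.
move=> xy; rewrite leNgt; apply/negP=> x0.
have y0 : 0 <= y / x by rewrite divr_ge0 ?(ltW x0) // (xy 0).
have := archi_boundP y0; rewrite ltr_pdivrMr // ltNge mulr_natl.
by rewrite xy.
Qed.

(** Nonnegativity in [R[i]] means zero imaginary part and nonnegative real part. So the multiples of
    [d] have bounded imaginary parts and real parts bounded below, and the real case applies to
    each. *)
Lemma complex_archimedean (d : R[i]) (w : nat -> R[i]) c :
  (forall N, 0 <= d *+ N + w N) -> (forall N, `|w N| <= c) -> 0 <= d.
Proof.
move=> dw wc.
have ReMn (z : R[i]) N : complex.Re (z *+ N) = complex.Re z *+ N.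
  by elim: N => [|N IH]; rewrite ?mulr0n // !mulrS -IH; case: z {IH} => ? ?; case: (_ *+ N).
have ImMn (z : R[i]) N : complex.Im (z *+ N) = complex.Im z *+ N.
  by elim: N => [|N IH]; rewrite ?mulr0n // !mulrS -IH; case: z {IH} => ? ?; case: (_ *+ N).
have ReD (z t : R[i]) : complex.Re (z + t) = complex.Re z + complex.Re t.
  by case: z; case: t.
have ImD (z t : R[i]) : complex.Im (z + t) = complex.Im z + complex.Im t.
  by case: z; case: t.
have RewN N : `|complex.Re (w N)| <= complex.Re c.
  have := le_trans (normc_ge_Re (w N)) (wc N).
  by rewrite lecE => /andP[].
have ImwN N : `|complex.Im (w N)| <= complex.Re c.
  have := le_trans (normc_ge_Re (w N * 'i%C)) (_ : _ <= c).
  rewrite ReiNIm normrM complexiE normCi mulr1 normrN => /(_ (wc N)).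
  by rewrite lecE => /andP[].
have dwRe N : 0 <= complex.Re d *+ N + complex.Re (w N).
  by have := dw N; rewrite lecE ReD ReMn => /andP[].
have dwIm N : complex.Im d *+ N = - complex.Im (w N).
  have := dw N; rewrite lecE ImD ImMn => /andP[/eqP /= E _].
  by apply/eqP; rewrite -addr_eq0 E.
rewrite lecE /= eq_le; apply/andP; split; [apply/andP; split|].
- apply: (@archimedean_le0 _ (complex.Re c)) => N; rewrite dwIm.
  by apply: le_trans (ImwN N); rewrite -normrN ler_norm.
- rewrite -oppr_le0; apply: (@archimedean_le0 _ (complex.Re c)) => N.
  by rewrite mulNrn dwIm opprK; apply: le_trans (ImwN N); rewrite ler_norm.
- rewrite -oppr_le0; apply: (@archimedean_le0 _ (complex.Re c)) => N.
  rewrite mulNrn; apply: le_trans (RewN N); apply: le_trans (ler_norm _).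
  by rewrite -subr_ge0 opprK addrC.
Qed.

End Archimedes.

(* [P] is the limit of the Cesaro means of [dual_map K], but it is defined
   algebraically, as the projection onto the fixed points along the image of
   [dual_map K - id]; positivity of the limit comes from the Archimedean
   property, because the telescoping sums below are bounded. *)
Section Ergodic.
Variables (R : realType) (I : finType) (n : nat) (K : I -> 'M[R[i]]_n).
Hypothesis sub1 : psd (1%:M - dual_map K 1%:M).
Local Notation F := (dual_map K).
Local Notation form X v := ((adjmx v *m X *m v) 0 0).

Lemma iter_dual_map_bound X (v : 'cV_n) :
  exists c, forall N, `|form (iter N F X) v| <= c.
Proof.
have [c c0 bX] := form_bound X.
exists (c * (adjmx v *m v) 0 0) => N; move: v.
by elim: N => [|N IH] v //=; apply: dual_map_bound.
Qed.

Lemma formD X Y (v : 'cV[R[i]]_n) : form (X + Y) v = form X v + form Y v.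
Proof. by rewrite mulmxDr mulmxDl mxE. Qed.

Lemma iter_coboundary A Y Z N : F A = A -> Y = A + (F Z - Z) ->
  iter N F Y = A + (iter N.+1 F Z - iter N F Z).
Proof.
move=> fA YE; elim: N => [|N IH] /=; first exact: YE.
by rewrite IH linearD linearB /= fA.
Qed.

Lemma sum_iter_form A Y Z (v : 'cV_n) N : F A = A -> Y = A + (F Z - Z) ->
  \sum_(k < N) form (iter k F Y) v =
  form A v *+ N + (form (iter N F Z) v - form Z v).
Proof.
move=> fA YE; elim: N => [|N IH]; first by rewrite big_ord0 subrr addr0.
rewrite big_ord_recr /= IH (iter_coboundary N fA YE) !formD mulrSr.
by rewrite mulmxN mulNmx [(- _ : 'M_1) 0 0]mxE; ring.
Qed.

(** The partial sums of the forms are nonnegative and, by telescoping, differ from [N] times the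
    form of [A] by a quantity bounded in [N]. *)
Lemma form_fixed_ge0 A Y Z (v : 'cV_n) : F A = A -> Y = A + (F Z - Z) ->
  (forall k, 0 <= form (iter k F Y) v) -> 0 <= form A v.
Proof.
move=> fA YE pY; have [c bc] := iter_dual_map_bound Z v.
apply: (complex_archimedean (w := fun N => form (iter N F Z) v - form Z v) (c := c + c)).
  by move=> N; rewrite -(sum_iter_form v N fA YE) sumr_ge0.
move=> N; apply: le_trans (ler_normB _ _) _; apply: lerD (bc N) (bc 0%N).
Qed.

(** The matrix 0 is [s *: X] plus a coboundary for every [s]; [form_fixed_ge0] at [s = 1] and
    [s = -1] bounds the form of [X] by 0 from both sides. *)
Lemma fixed_coboundary_eq0 X Z : F X = X -> X = F Z - Z -> X = 0.
Proof.
move=> fX XE; apply: form_inj => v; rewrite mulmx0 mul0mx [RHS]mxE.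
have ge0 s : 0 <= form (s *: X) v.
  apply: (@form_fixed_ge0 (s *: X) 0 (- (s *: Z))).
  - by rewrite linearZ /= fX.
  - by rewrite linearN linearZ /= -opprD -scalerBr -XE subrr.
  move=> k; have -> : iter k F 0 = 0 by elim: k => //= k ->; rewrite linear0.
  by rewrite mulmx0 mul0mx mxE.
apply/eqP; rewrite eq_le; apply/andP; split.
  rewrite -oppr_ge0; have := ge0 (-1).
  by rewrite -scalemxAr -scalemxAl mxE mulN1r.
by have := ge0 1; rewrite scale1r.
Qed.

(** The kernel and the image of [F - id] meet trivially by [fixed_coboundary_eq0], so by
    rank-nullity they are complementary; [P] projects onto the kernel. *)
Lemma ergodic_decomposition : exists P : {linear 'M[R[i]]_n -> 'M[R[i]]_n},
  (forall Y, F (P Y) = P Y) /\ (forall Y, exists Z, Y = P Y + (F Z - Z)).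
Proof.
pose f : 'End('M[R[i]]_n) := (linfun F - \1)%VF.
have fE X : f X = F X - X by rewrite /f add_lfunE opp_lfunE id_lfunE lfunE.
have cap0 : (lker f :&: limg f = 0)%VS.
  apply/eqP; rewrite -subv0; apply/subvP => X /memv_capP [].
  rewrite memv_ker fE subr_eq0 memv0 => /eqP fX /memv_imgP [Z _].
  by rewrite fE => XE; rewrite (fixed_coboundary_eq0 fX XE).
have addT : (lker f + limg f = fullv)%VS.
  apply/eqP; rewrite eqEdim subvf dimv_disjoint_sum //.
  by rewrite -(limg_ker_dim f fullv) capfv leqnn.
exists (daddv_pi (lker f) (limg f)); split=> Y.
  have := memv_pi (lker f) (limg f) Y; rewrite memv_ker fE subr_eq0.
  by move/eqP.
have := memv_pi (limg f) (lker f) Y; case/memv_imgP => Z _; rewrite fE => ZE.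
by exists Z; rewrite -ZE; apply/esym/daddv_pi_add; rewrite ?addT ?memvf.
Qed.

End Ergodic.

(** The difference of two such decompositions of [Y] exhibits [P Y - A] as a fixed point that is
    also a coboundary. *)
Lemma ergodic_projection_unique (R : realType) (I : finType) n
    (K : I -> 'M[R[i]]_n) (P : {linear 'M[R[i]]_n -> 'M[R[i]]_n}) A Y Z :
  psd (1%:M - dual_map K 1%:M) ->
  (forall Y, dual_map K (P Y) = P Y) ->
  (forall Y, exists Z, Y = P Y + (dual_map K Z - Z)) ->
  dual_map K A = A -> Y = A + (dual_map K Z - Z) -> P Y = A.
Proof.
move=> sub1 fP dP fA YE; have [Z' YE'] := dP Y; apply/eqP; rewrite -subr_eq0; apply/eqP.
apply: (fixed_coboundary_eq0 sub1 (Z := Z - Z')).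
  by rewrite linearB /= fP fA.
rewrite linearB /= opprD addrACA -opprD.
apply/eqP; rewrite subr_eq [X in _ == X]addrC addrA -YE; apply/eqP.
by rewrite [X in X - _]YE' addrK.
Qed.

(** * The fixed points of a marginal *)

Section Faithful.
Variables (C : numClosedFieldType) (I : finType) (n : nat).
Variables (M : I -> 'M[C]_n) (rho Q : 'M[C]_n).
Hypothesis psd_rho : psd rho.
Hypothesis adjQ : adjmx Q = Q.
(** In the application [Q] is the support projection of [rho]; this condition says that [rho] is
    faithful on its range. *)
Hypothesis faithfulQ : forall m (Z : 'M_(m, n)), Z *m rho = 0 -> Z *m Q = 0.
Hypothesis MQ : forall i, M i *m Q = M i.
Hypothesis dual1 : dual_map M 1%:M = Q.
Hypothesis inv_rho : kraus_map M rho = rho.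
Local Notation F := (dual_map M).

Lemma dual_fixed_corner A : F A = A -> A *m Q = A /\ Q *m A = A.
Proof.
move=> <-; rewrite mulmx_suml mulmx_sumr; split; apply: eq_bigr => i _.
  by rewrite -mulmxA MQ.
by rewrite !mulmxA -[Q]adjQ -adjmxM MQ.
Qed.

(** [F 1%:M - F Q] is the sum of the squares of [M i - Q *m M i], and invariance of [rho] makes its
    trace against [rho] vanish. Faithfulness then gives [Q *m M i = M i]. *)
Lemma dual_fixed_support : F Q = Q.
Proof.
have QQ : Q *m Q = Q.
  have : F 1%:M *m Q = F 1%:M.
    by rewrite mulmx_suml; apply: eq_bigr => i _; rewrite -mulmxA MQ.
  by rewrite dual1.
have Z0 i : (M i - Q *m M i) *m rho = 0.
  apply: (faithful_sum (Z := fun i => M i - Q *m M i)) psd_rho _ i.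
  have E i : adjmx (M i - Q *m M i) *m (M i - Q *m M i) =
      adjmx (M i) *m 1%:M *m M i - adjmx (M i) *m Q *m M i.
    rewrite adjmxB adjmxM adjQ mulmxBr !mulmxBl mulmx1 !mulmxA.
    by rewrite -[_ *m Q *m Q]mulmxA QQ subrr subr0.
  rewrite (eq_bigr (fun i => \tr (rho *m (adjmx (M i) *m 1%:M *m M i)) -
     \tr (rho *m (adjmx (M i) *m Q *m M i)))); last first.
    by move=> j _; rewrite E mulmxBr raddfB.
  have trF X : \sum_i \tr (rho *m (adjmx (M i) *m X *m M i)) = \tr (rho *m X).
    by rewrite -[in RHS]inv_rho -mxtrace_dual_map mulmx_sumr raddf_sum.
  by rewrite sumrB !trF -dual1 mxtrace_dual_map inv_rho subrr.
rewrite -[RHS]dual1; apply: eq_bigr => i _.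
have /eqP := faithfulQ (Z0 i); rewrite mulmxBl -(mulmxA Q) !MQ subr_eq0.
by move=> /eqP QM; rewrite mulmx1 -mulmxA -QM.
Qed.

(* Equality in the Kadison-Schwarz inequality. *)
Lemma dual_fixed_commute A : F A = A -> forall i, A *m M i = M i *m A.
Proof.
move=> fA i; have [AQ QA] := dual_fixed_corner fA.
have fA' : F (adjmx A) = adjmx A by rewrite -adjmx_dual_map fA.
pose Z i := A *m M i - M i *m A.
have E j : adjmx (Z j) *m Z j =
    adjmx (M j) *m (adjmx A *m A) *m M j
    - (adjmx (M j) *m adjmx A *m M j) *m A
    - adjmx A *m (adjmx (M j) *m A *m M j)
    + adjmx A *m (adjmx (M j) *m 1%:M *m M j) *m A.
  rewrite /Z adjmxB !adjmxM mulmxBl !mulmxBr mulmx1 !mulmxA.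
  by rewrite opprB addrA [RHS]addrAC.
(* The squared commutators add up to the Kadison-Schwarz defect, whose trace against the invariant
   [rho] is zero. Here [F 1%:M] is only [Q], absorbed by [Q *m A = A]. *)
have sumZ : \sum_j adjmx (Z j) *m Z j = F (adjmx A *m A) - adjmx A *m A.
  transitivity (F (adjmx A *m A) - F (adjmx A) *m A - adjmx A *m F A
                + adjmx A *m F 1%:M *m A).
    rewrite (eq_bigr _ (fun j _ => E j)) big_split !sumrB /=.
    by rewrite /dual_map !(mulmx_sumr, mulmx_suml).
  by rewrite fA fA' dual1 -[_ *m Q *m A]mulmxA QA subrK.
have Z0 : Z i *m rho = 0.
  apply: (faithful_sum (Z := Z)) => //.
  transitivity (\tr (rho *m \sum_j adjmx (Z j) *m Z j)).
    by rewrite mulmx_sumr raddf_sum.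
  by rewrite sumZ mulmxBr raddfB /= mxtrace_dual_map inv_rho subrr.
have := faithfulQ Z0; rewrite mulmxBl -!mulmxA MQ AQ => /eqP.
by rewrite subr_eq0 => /eqP.
Qed.

(** The adjoint of [A] is fixed too, so [A] commutes with every [adjmx (M i)] and leaves the sum on
    the left. *)
Lemma dual_fixed_mull A X : F A = A -> F (A *m X) = A *m F X.
Proof.
move=> fA; rewrite mulmx_sumr; apply: eq_bigr => i _.
have fA' : F (adjmx A) = adjmx A by rewrite -adjmx_dual_map fA.
have := congr1 (@adjmx _ _ _) (dual_fixed_commute fA' i).
by rewrite !adjmxM adjmxK !mulmxA => ->.
Qed.

Lemma dual_fixed_mulr A X : F A = A -> F (X *m A) = F X *m A.
Proof.
move=> fA; rewrite mulmx_suml; apply: eq_bigr => i _.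
by rewrite -!mulmxA (dual_fixed_commute fA).
Qed.

End Faithful.

(** * Commutation between the two tensor legs *)

Section Slices.
Variables (C : numClosedFieldType) (n : nat).

Lemma slice2M (K : 'M[C]_(n * n, n)) A b : slice2 (K *m A) b = slice2 K b *m A.
Proof. by apply/matrixP=> i j; rewrite !mxE; apply: eq_bigr => k _; rewrite mxE. Qed.

Lemma slice1M (K : 'M[C]_(n * n, n)) A a : slice1 (K *m A) a = slice1 K a *m A.
Proof. by apply/matrixP=> i j; rewrite !mxE; apply: eq_bigr => k _; rewrite mxE. Qed.

(** The hypothesis says that [K *m A] equals [A] acting on the first leg after [K]; the conclusion
    reads this identity with the first index fixed to [a]. *)
Lemma slice1_commute (K : 'M[C]_(n * n, n)) A :
  (forall b, A *m slice2 K b = slice2 K b *m A) ->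
  forall a, slice1 K a *m A = \sum_c A a c *: slice1 K c.
Proof.
move=> comA a; apply/matrixP=> b j.
have /matrixP/(_ a j) := comA b; rewrite !mxE summxE => E.
transitivity (\sum_k slice2 K b a k * A k j).
  by apply: eq_bigr => k _; rewrite !mxE.
by rewrite -E; apply: eq_bigr => c _; rewrite !mxE.
Qed.

(** [A] passes through [K l] to the first leg, where it commutes with [B] on the second leg, and
    passes back out on the other side. The left-hand passage uses the hypothesis on [adjmx A]. *)
Lemma dual_slice1_commute (I : finType) (K : I -> 'M[C]_(n * n, n)) A B :
  (forall l b, A *m slice2 (K l) b = slice2 (K l) b *m A) ->
  (forall l b, adjmx A *m slice2 (K l) b = slice2 (K l) b *m adjmx A) ->
  let N (x : I * 'I_n) := slice1 (K x.1) x.2 in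
  A *m dual_map N B = dual_map N B *m A.
Proof.
move=> cA cA' N.
have sumN X : dual_map N X = \sum_l \sum_a
    adjmx (slice1 (K l) a) *m X *m slice1 (K l) a.
  by rewrite pair_bigA.
rewrite sumN mulmx_sumr mulmx_suml; apply: eq_bigr => l _.
rewrite mulmx_sumr mulmx_suml.
have EL a : A *m (adjmx (slice1 (K l) a) *m B *m slice1 (K l) a) =
    \sum_c A c a *: (adjmx (slice1 (K l) c) *m B *m slice1 (K l) a).
  have := congr1 (@adjmx _ _ _) (slice1_commute (cA' l) a).
  rewrite adjmxM adjmxK adjmx_sum !mulmxA => ->.
  rewrite !mulmx_suml; apply: eq_bigr => c _.
  by rewrite adjmxZ adjmxE conjCK -!scalemxAl.
have ER a : adjmx (slice1 (K l) a) *m B *m slice1 (K l) a *m A =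
    \sum_c A a c *: (adjmx (slice1 (K l) a) *m B *m slice1 (K l) c).
  rewrite -mulmxA (slice1_commute (cA l)) mulmx_sumr.
  by apply: eq_bigr => c _; rewrite -scalemxAr.
by rewrite (eq_bigr _ (fun a _ => EL a)) (eq_bigr _ (fun a _ => ER a)) exchange_big.
Qed.

End Slices.

(** * Supports of psd matrices *)

Section Support.
Variable C : numClosedFieldType.

(** After conjugation by [Z] the two traces are nonnegative with sum 0, so both vanish. *)
Lemma psd_add_ker m n (A B : 'M[C]_n) (Z : 'M_(m, n)) :
  psd A -> psd B -> Z *m (A + B) = 0 -> Z *m A = 0.
Proof.
move=> pA pB ZAB.
have E : \tr (Z *m A *m adjmx Z) + \tr (Z *m B *m adjmx Z) = 0.
  by rewrite -raddfD /= -mulmxDl -mulmxDr ZAB mul0mx mxtrace0.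
have pZ X : psd X -> 0 <= \tr (Z *m X *m adjmx Z).
  by move=> pX; apply/psd_mxtrace/psd_conjmx.
have /andP[/eqP EA _] : (\tr (Z *m A *m adjmx Z) == 0) && (\tr (Z *m B *m adjmx Z) == 0).
  by rewrite -paddr_eq0 ?pZ // E.
case/psd_factor: pA EA => D -> EA; rewrite mulmxA (mxtrace_gram_eq0 (Z := Z *m D)) ?mul0mx //.
by rewrite adjmxM -EA !mulmxA.
Qed.

Lemma support_projection n (A : 'M[C]_n) : psd A ->
  exists Q W, [/\ adjmx Q = Q, Q *m Q = Q, Q *m A = A & Q = A *m W].
Proof.
case/psd_spectral => U [d [UU UU' d0 ->]].
pose e : 'rV[C]_n := \row_i (d 0 i != 0)%:R.
(* Since the inverse of 0 is 0, the second witness is the pseudo-inverse of the matrix. *)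
exists (adjmx U *m diag_mx e *m U), (adjmx U *m diag_mx (map_mx GRing.inv d) *m U).
have mulU X Y : adjmx U *m X *m U *m (adjmx U *m Y *m U) = adjmx U *m (X *m Y) *m U.
  by rewrite !mulmxA -[_ *m U *m adjmx U]mulmxA UU mulmx1.
split.
- rewrite !adjmxM adjmxK mulmxA; congr (_ *m _ *m _).
  apply/matrixP=> i j; rewrite adjmxE !mxE.
  by case: (eqVneq i j) => [->|_]; rewrite ?mulr1n ?mulr0n ?conjC_nat ?conjC0.
- rewrite mulU; congr (_ *m _ *m _); apply/matrixP=> i j.
  rewrite mul_diag_mx !mxE; case: (eqVneq i j) => [->|_]; rewrite ?mulr0n ?mulr0 // !mulr1n.
  by case: eqP => _; rewrite ?mulr0 ?mulr1.
- rewrite mulU; congr (_ *m _ *m _); apply/matrixP=> i j.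
  rewrite mul_diag_mx !mxE; case: (eqVneq i j) => [->|_]; rewrite ?mulr0n ?mulr0 // !mulr1n.
  by case: eqP => [->|_]; rewrite ?mulr0 ?mul1r.
- rewrite mulU; congr (_ *m _ *m _); apply/matrixP=> i j.
  rewrite mul_diag_mx !mxE; case: (eqVneq i j) => [->|_]; rewrite ?mulr0n ?mulr0 // !mulr1n.
  by case: eqP => [->|/eqP d0']; rewrite ?mul0r ?mulfV.
Qed.

(** An element [rho] of maximal rank works: the kernel of [A + rho] lies in that of [rho] by
    positivity, and maximality forces equality, so the kernel of [rho] also kills [A]. *)
Lemma max_support n (S : 'M[C]_n -> Prop) :
  (forall A, S A -> psd A) -> (forall A B, S A -> S B -> S (A + B)) -> S 0 ->
  exists2 rho, S rho & forall A, S A -> forall m (Z : 'M_(m, n)),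
    Z *m rho = 0 -> Z *m A = 0.
Proof.
move=> pS addS S0.
have [rho Srho max] : exists2 rho, S rho & forall A, S A -> (\rank A <= \rank rho)%N.
  have [d le_d] := ubnP (n - \rank (0 : 'M[C]_n)).
  elim: d 0 S0 le_d => // d IH A SA le_d.
  have [[B SB ltB]|noB] := pselect (exists2 B, S B & (\rank A < \rank B)%N).
    apply: (IH B SB); apply: leq_trans (ltn_sub2l _ ltB) _ => //.
    by apply: leq_trans ltB (rank_leq_row B).
  exists A => // B SB; rewrite leqNgt; apply/negP => ltB.
  by apply: noB; exists B.
exists rho => // A SA m Z Z0.
have SD := addS _ _ SA Srho.
have kle : (kermx (A + rho) <= kermx rho)%MS.
  apply/sub_kermxP; apply: (@psd_add_ker _ _ _ A); [exact: pS|exact: pS|].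
  by rewrite addrC mulmx_ker.
have kge : (kermx rho <= kermx (A + rho))%MS.
  have := mxrank_leqif_sup kle; rewrite /leqif => -[_ <-].
  by rewrite eqn_leq mxrankS // !mxrank_ker leq_sub2l // max.
apply: (@psd_add_ker _ _ _ rho); [exact: pS|exact: pS|].
by apply/sub_kermxP; apply: submx_trans kge; apply/sub_kermxP.
Qed.

End Support.

(** * Positive maps with commutative range *)

Section CommutingRange.
Variables (C : numClosedFieldType) (n : nat).

(** A unitary trigonalises the commuting images of the matrix units at once. Images of psd matrices
    are Hermitian, so for rank-one psd inputs the other triangle vanishes as well, and
    [linear_rank1_eq0] extends this to all inputs. *)
Lemma codiagonalize_positive (Phi : {linear 'M[C]_n -> 'M[C]_n}) :
  (forall X, psd X -> psd (Phi X)) ->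
  (forall X Y, Phi X *m Phi Y = Phi Y *m Phi X) ->
  exists U : 'M[C]_n, [/\ U *m adjmx U = 1%:M, adjmx U *m U = 1%:M &
    forall X i j, i != j -> (U *m Phi X *m adjmx U) i j = 0].
Proof.
move=> pos comm.
have [|U uU /allP trigU] := @cotrigonalization C n
    [seq Phi (delta_mx p.1 p.2) | p : 'I_n * 'I_n].
  by move=> _ _ /mapP[p _ ->] /mapP[q _ ->]; apply: comm.
have /unitarymxP UU := uU.
have UU' : adjmx U *m U = 1%:M by exact: mulmx1C UU.
exists U; split=> // X i j neq_ij.
have lin i' j' : scalar (fun X => (U *m Phi X *m adjmx U) i' j').
  by move=> a Y Z; rewrite linearP mulmxDr mulmxDl -scalemxAr -scalemxAl !mxE.
pose f i' j' : {linear 'M[C]_n -> C^o} := HB.pack (fun X => (U *m Phi X *m adjmx U) i' j')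
  (GRing.isLinear.Build _ _ _ _ _ (lin i' j')).
have lt0 (i' j' : 'I_n) Y : (i' < j')%N -> f i' j' Y = 0.
  move=> lt_ij; rewrite [Y]matrix_sum_delta linear_sum big1 // => k _.
  rewrite linear_sum big1 // => l _; rewrite linearZ /=.
  have /trigU : Phi (delta_mx k l) \in [seq Phi (delta_mx p.1 p.2) | p : 'I_n * 'I_n].
    by apply/mapP; exists (k, l); rewrite ?mem_enum.
  by rewrite /= /similar_to conjymx // => /is_trig_mxP /(_ _ _ lt_ij) ->; rewrite scaler0.
rewrite -[LHS]/(f i j X); case: (ltngtP i j) => [/lt0-> //|lt_ji|/val_inj eq_ij].
  apply: (linear_rank1_eq0 (f := f i j)) => v /=.
  rewrite -[U *m _ *m _]psd_adjmx; first by rewrite adjmxE [X in X^*](lt0 j i) ?conjC0.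
  exact/psd_conjmx/pos/psd_gram.
by rewrite eq_ij eqxx in neq_ij.
Qed.

(** In the common eigenbasis, [Phi X] is the sum of the [\tr (s j *m X) *: G j]; its predual
    measures [G] and prepares [s]. *)
Lemma entanglement_breaking_commuting_range (T : 'M[C]_n -> Prop)
    (Phi : {linear 'M[C]_n -> 'M[C]_n}) (sigma0 : 'M[C]_n) :
  density sigma0 -> (forall rho, T rho -> density rho) ->
  (forall X, psd X -> psd (Phi X)) -> psd (1%:M - Phi 1%:M) ->
  (forall X Y, Phi X *m Phi Y = Phi Y *m Phi X) ->
  (forall rho X, T rho -> \tr (rho *m Phi X) = \tr (rho *m X)) ->
  exists L : 'M[C]_n -> 'M[C]_n,
    entanglement_breaking L /\ forall rho, T rho -> L rho = rho.
Proof.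
move=> [ps0 trs0] dT pos sub1 comm fixT.
have [U [UU UU' diagU]] := codiagonalize_positive pos comm.
pose G (j : 'I_n) := adjmx U *m delta_mx j j *m U.
(* The matrix representing the functional that gives the [j]-th eigenvalue of [Phi X], see [sE]. *)
pose s (j : 'I_n) := \matrix_(a, b) (U *m Phi (delta_mx b a) *m adjmx U) j j : 'M[C]_n.
(* [Phi] is only subunital, so [s j] may have trace below 1; [sigma0] fills the gap. *)
pose sigma j := s j + (1 - \tr (s j)) *: sigma0.
have sE j X : \tr (s j *m X) = (U *m Phi X *m adjmx U) j j.
  rewrite [in RHS](matrix_sum_delta X) linear_sum mulmx_sumr mulmx_suml summxE.
  rewrite mxtrace_mulC; apply: eq_bigr => a _.
  rewrite mxE linear_sum mulmx_sumr mulmx_suml summxE; apply: eq_bigr => b _.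
  by rewrite linearZ /= -scalemxAr -scalemxAl [RHS]mxE [s j b a]mxE.
have psds j : psd (s j).
  by move=> v; rewrite -mxtrace_rank1 sE; apply/psd_diag/psd_conjmx/pos/psd_gram.
have trs j : \tr (s j) <= 1.
  rewrite -[s j]mulmx1 sE -subr_ge0.
  have := psd_diag j (psd_conjmx U sub1).
  by rewrite mulmxBr mulmxBl mulmx1 UU mxE [1%:M j j]mxE eqxx [X in _ + X]mxE.
have recon rho X : \tr ((\sum_j \tr (rho *m G j) *: s j) *m X) = \tr (rho *m Phi X).
  have -> : Phi X = \sum_j (U *m Phi X *m adjmx U) j j *: G j.
    transitivity (adjmx U *m (U *m Phi X *m adjmx U) *m U).
      by rewrite !mulmxA UU' mul1mx -mulmxA UU' mulmx1.
    rewrite [X in _ *m X *m U]matrix_sum_delta mulmx_sumr mulmx_suml.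
    apply: eq_bigr => i _; rewrite mulmx_sumr mulmx_suml (bigD1 i) //= big1 ?addr0.
      by rewrite -scalemxAr -scalemxAl.
    by move=> j neq_ji; rewrite diagU ?scale0r ?mulmx0 ?mul0mx // eq_sym.
  rewrite mulmx_suml mulmx_sumr !raddf_sum; apply: eq_bigr => j _ /=.
  by rewrite -scalemxAl -scalemxAr !mxtraceZ sE mulrC.
have sumG : \sum_j G j = 1%:M.
  by rewrite -mulmx_suml -mulmx_sumr -mx1_sum_delta mulmx1.
exists (mp_map G sigma); split.
  exists n, G, sigma; split; [split=> // j|split=> // j].
    rewrite /G -(mul_delta_mx (0 : 'I_1)) -mulmxA -mulmxA mulmxA -[delta_mx 0 j *m U]adjmxK.
    by rewrite adjmxM adjmx_delta; apply: psd_gram.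
  split; first by apply: psdD => //; apply: psdZ => //; rewrite subr_ge0.
  by rewrite mxtraceD mxtraceZ trs0 mulr1 addrC subrK.
move=> rho Trho; have [_ tr_rho] := dT _ Trho.
(* The total weight that the filling receives from [rho]; it is 0 because the unfilled map already
   preserves the trace of [rho]. *)
pose c := \sum_j \tr (rho *m G j) * (1 - \tr (s j)).
have sumE : \sum_j \tr (rho *m G j) *: s j = rho.
  by apply: mxtrace_form_inj => X; rewrite recon fixT.
have c0 : c = 0.
  rewrite /c (eq_bigr _ (fun j _ => mulrBr _ _ _)) sumrB.
  under eq_bigr do rewrite mulr1.
  under [X in _ - X]eq_bigr do rewrite -mxtraceZ.
  have /(congr1 (fun X => \tr (rho *m X))) := sumG.
  rewrite mulmx_sumr raddf_sum mulmx1 /= => ->.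
  by rewrite -raddf_sum sumE subrr.
rewrite /mp_map; under eq_bigr do rewrite scalerDr scalerA.
by rewrite big_split /= sumE -scaler_suml -/c c0 scale0r addr0.
Qed.

Lemma observables_separate (X Y : 'M[C]_n) :
  (forall k (A : 'I_k -> 'M[C]_n), povm A -> forall i, \tr (A i *m X) = \tr (A i *m Y)) ->
  X = Y.
Proof.
move=> eqXY; apply: form_inj => v; rewrite -!mxtrace_rank1 mxtrace_mulC [RHS]mxtrace_mulC.
set E := v *m adjmx v.
have [c c0 bE] := form_bound E.
have c1 : 0 < c + 1 by rewrite ltr_wpDl.
(* Dividing by [c + 1] keeps the scaled projector below the identity and avoids division by 0. *)
pose A0 := (c + 1)^-1 *: E; pose A (i : 'I_2) := if i == 0 then A0 else 1%:M - A0.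
have povmA : povm A.
  split=> [i|]; last by rewrite big_ord_recl big_ord1 /A /= addrC subrK.
  rewrite /A; case: ifP => _.
    by apply: psdZ; [rewrite invr_ge0 ltW|apply: psd_gram].
  move=> w; rewrite mulmxBr mulmxBl mulmx1 /A0 -scalemxAr -scalemxAl.
  rewrite mxE [X in _ + X]mxE [X in _ - X]mxE subr_ge0 mulrC ler_pdivrMr // mulrC.
  apply: le_trans (real_ler_norm _) _; first by apply/ger0_real/psd_gram.
  by apply: le_trans (bE w) _; rewrite ler_wpM2r ?sqnorm_ge0 // lerDl.
have := eqXY _ A povmA 0; rewrite /A /= -!scalemxAl !mxtraceZ.
by apply: mulfI; rewrite invr_eq0 gt_eqF.
Qed.

End CommutingRange.

(** * From broadcasting to measure-and-prepare channels *)

Section Backward.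
Variables (R : realType) (n : nat).
Local Notation C := R[i].

Lemma broadcast_entanglement_breaking (T : 'M[C]_n -> Prop) (sigma0 : 'M[C]_n) :
  density sigma0 -> (forall rho, T rho -> density rho) ->
  broadcastable T (all_observables n) (all_observables n) ->
  exists L : 'M[C]_n -> 'M[C]_n,
    entanglement_breaking L /\ forall rho, T rho -> L rho = rho.
Proof.
move=> ds0 dT [L [[linL [cpL tpL]] [obs2 obs1]]].
have [K KE] := cp_kraus linL cpL.
have L2 X : ptr2 (L X) =
    kraus_map (fun x : 'I_(n * (n * n)) * 'I_n => slice2 (K x.1) x.2) X.
  rewrite KE ptr2_sum /kraus_map -(pair_bigA _ (fun l b => slice2 (K l) b *m X *m adjmx (slice2 (K l) b))).
  by apply: eq_bigr => l _; rewrite ptr2_conj.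
have L1 X : ptr1 (L X) =
    kraus_map (fun x : 'I_(n * (n * n)) * 'I_n => slice1 (K x.1) x.2) X.
  rewrite KE ptr1_sum /kraus_map -(pair_bigA _ (fun l b => slice1 (K l) b *m X *m adjmx (slice1 (K l) b))).
  by apply: eq_bigr => l _; rewrite ptr1_conj.
(* Unnormalised matrices are taken so that the set is closed under addition and contains 0, as
   [max_support] requires. *)
pose S X := [/\ psd X, ptr2 (L X) = X & ptr1 (L X) = X].
have ST rho : T rho -> S rho.
  move=> Trho; split; first by case: (dT _ Trho).
    by apply: observables_separate => k A pA i; apply: obs2.
  by apply: observables_separate => k A pA i; apply: obs1.
have SD A B : S A -> S B -> S (A + B).
  move=> [pA A2 A1] [pB B2 B1]; split; first exact: psdD.
    by rewrite L2 -[A]scale1r kraus_map_linear -!L2 A2 B2.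
  by rewrite L1 -[A]scale1r kraus_map_linear -!L1 A1 B1.
have S0 : S 0.
  have k0 (I : finType) (N : I -> 'M[C]_n) : kraus_map N 0 = 0.
    by rewrite /kraus_map big1 // => i _; rewrite mulmx0 mul0mx.
  by split; [exact: psd0|rewrite L2 k0|rewrite L1 k0].
have [rho Srho suppS] := max_support (fun A (SA : S A) => let: And3 p _ _ := SA in p) SD S0.
have [prho rho2 rho1] := Srho.
have [Q [W [adjQ QQ Qrho QW]]] := support_projection prho.
have QS X : S X -> Q *m X *m Q = X.
  move=> SX; have QX : Q *m X = X.
    apply/eqP; rewrite eq_sym -subr_eq0 -{1}[X]mul1mx -mulmxBl; apply/eqP.
    by apply: suppS SX _ _ _; rewrite mulmxBl mul1mx Qrho subrr.
  rewrite QX; case: SX => pX _ _.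
  by rewrite -[LHS]adjmxK adjmxM adjQ (psd_adjmx pX) QX psd_adjmx.
have faithQ m (Z : 'M_(m, n)) : Z *m rho = 0 -> Z *m Q = 0.
  by move=> Z0; rewrite QW mulmxA Z0 mul0mx.
(* The Kraus operators of both marginals, cut down to the support of [rho] on the input side
   only. *)
pose M (x : 'I_(n * (n * n)) * 'I_n) := slice2 (K x.1 *m Q) x.2.
pose N (x : 'I_(n * (n * n)) * 'I_n) := slice1 (K x.1 *m Q) x.2.
have kM X : kraus_map M X = ptr2 (L (Q *m X *m Q)).
  rewrite L2; apply: eq_bigr => x _; rewrite /M slice2M adjmxM adjQ.
  by rewrite !mulmxA.
have kN X : kraus_map N X = ptr1 (L (Q *m X *m Q)).
  rewrite L1; apply: eq_bigr => x _; rewrite /N slice1M adjmxM adjQ.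
  by rewrite !mulmxA.
have SM X : S X -> kraus_map M X = X by move=> SX; rewrite kM QS //; case: SX.
have SN X : S X -> kraus_map N X = X by move=> SX; rewrite kN QS //; case: SX.
have MQ x : M x *m Q = M x by rewrite /M slice2M -mulmxA QQ.
have dual1 (J : finType) (V : J -> 'M[C]_n) :
    (forall X, \tr (kraus_map V X) = \tr (Q *m X *m Q)) -> dual_map V 1%:M = Q.
  move=> trV; apply: mxtrace_form_inj => X.
  rewrite mxtrace_mulC mxtrace_dual_map mulmx1 trV mxtrace_mulC mulmxA QQ.
  by [].
have dualM : dual_map M 1%:M = Q.
  by apply: dual1 => X; rewrite kM mxtrace_ptr2 tpL.
have dualN : dual_map N 1%:M = Q.
  by apply: dual1 => X; rewrite kN mxtrace_ptr1 tpL.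
have sub1Q : psd (1%:M - Q).
  have -> : 1%:M - Q = (1%:M - Q) *m adjmx (1%:M - Q).
    by rewrite adjmxB adjmx1 adjQ mulmxBr mulmx1 mulmxBl mul1mx QQ subrr subr0.
  exact: psd_gram.
have sub1 : psd (1%:M - dual_map M 1%:M) by rewrite dualM.
have [P [fixP decP]] := ergodic_decomposition sub1.
have uniqP := ergodic_projection_unique sub1 fixP decP.
have fcomm := dual_fixed_commute prho adjQ faithQ MQ dualM (SM _ Srho).
(* Multiplying a decomposition of [X] by a fixed point gives a decomposition of the product, so
   uniqueness identifies its fixed part. *)
have Pl A X : dual_map M A = A -> P (A *m X) = A *m P X.
  move=> fA; have [Z XE] := decP X; apply: (uniqP _ _ (A *m Z)).
    by rewrite (dual_fixed_mull prho adjQ faithQ MQ dualM (SM _ Srho)) ?fixP.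
  rewrite (dual_fixed_mull prho adjQ faithQ MQ dualM (SM _ Srho)) //.
  by rewrite -mulmxBr -mulmxDr -XE.
have Pr A X : dual_map M A = A -> P (X *m A) = P X *m A.
  move=> fA; have [Z XE] := decP X; apply: (uniqP _ _ (Z *m A)).
    by rewrite (dual_fixed_mulr prho adjQ faithQ MQ dualM (SM _ Srho)) ?fixP.
  rewrite (dual_fixed_mulr prho adjQ faithQ MQ dualM (SM _ Srho)) //.
  by rewrite -mulmxBl -mulmxDl -XE.
have commN A B : dual_map M A = A -> A *m dual_map N B = dual_map N B *m A.
  move=> fA; apply: (dual_slice1_commute (K := fun l => K l *m Q)) => l b.
    exact: fcomm (l, b).
  by apply: (fcomm _ _ (l, b)); rewrite -adjmx_dual_map fA.
pose Phi : {linear 'M[C]_n -> 'M[C]_n} := P \o dual_map N.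
apply: (entanglement_breaking_commuting_range (Phi := Phi) ds0 dT).
(* [P] inherits positivity because all iterates of a psd matrix under [dual_map M] are psd. *)
- move=> X pX v /=; have [Z ZE] := decP (dual_map N X).
  apply: (form_fixed_ge0 sub1 (fixP _) ZE) => k.
  suff pk : psd (iter k (dual_map M) (dual_map N X)) by exact: pk.
  by elim: k => [|k IH] /=; apply: dual_map_psd.
- rewrite /= dualN (uniqP Q _ 0) //.
    exact: dual_fixed_support prho adjQ faithQ MQ dualM (SM _ Srho).
  by rewrite linear0 subrr addr0.
(* With [A] the left factor: [A *m P Y' = P (A *m Y') = P (Y' *m A) = P Y' *m A], where
   [Y' = dual_map N Y]. *)
- move=> X Y /=; rewrite -Pl ?fixP // commN ?fixP // Pr //.
(* The coboundary separating [Y] from [P Y] has zero trace against [s], which the first marginal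
   fixes. *)
- move=> s X Ts /=; have [Z ZE] := decP (dual_map N X).
  have <- : \tr (s *m dual_map N X) = \tr (s *m X).
    by rewrite mxtrace_dual_map SN //; apply: ST.
  rewrite [in RHS]ZE mulmxDr mulmxBr mxtraceD raddfB /= mxtrace_dual_map SM ?subrr ?addr0 //.
  exact: ST.
Qed.

End Backward.

Theorem theorem1 (R : realType) (n : nat) (T : 'M[R[i]]_n -> Prop) :
  (forall rho, T rho -> density rho) ->
  ((exists L : 'M[R[i]]_n -> 'M[R[i]]_n,
      entanglement_breaking L /\ (forall rho, T rho -> L rho = rho)) <->
   broadcastable T (all_observables n) (all_observables n)).
Proof.
move=> dT; split=> [[L [ebL fixL]]|bT].
  exact: entanglement_breaking_broadcast ebL fixL.
(* A state to serve as [sigma0] exists only in positive dimension. In dimension 0 every trace is 0,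
   so [T] is empty. *)
case: n T dT bT => [|n] T dT bT; last first.
  apply: (@broadcast_entanglement_breaking _ _ _ (delta_mx 0 0)) dT bT; split.
    by rewrite -[delta_mx 0 0](mul_delta_mx (0 : 'I_1)) -[X in _ *m X]adjmx_delta; apply: psd_gram.
  rewrite /mxtrace (bigD1 0) //= mxE eqxx big1 ?addr0 // => i /negPf ne.
  by rewrite mxE ne.
have T0 rho : ~ T rho.
  by case/dT => _ /eqP; rewrite /mxtrace big_ord0 eq_sym oner_eq0.
exists (fun _ => 0); split; last by move=> rho /T0.
(* The empty family is a POVM here, as all matrices of size 0 are equal. *)
exists 0%N, (fun _ => 0), (fun _ => 0); split; [split|split].
- by move=> i; apply: psd0.
- by rewrite big_ord0; apply/matrixP=> -[].
- by case.
- by move=> rho; rewrite /mp_map big_ord0.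
Qed.
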